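(* Let $G$ be a finitely generated nilpotent group of class $c\ge 2$ given by a finite full rank presentation $G=\langle a_1,\dots,a_n\mid r_1,\dots,r_m\rangle_{\mathcal N_c}$. If $m\le n-2$, then $Z(G)\le G'$. In particular, $G$ is regular.
   Context: $Z(G)$ is the center and $G'=[G,G]$ the derived subgroup of $G$. The isolator of a subgroup $H\le G$ is $\mathrm{Is}(H)=\{g\in G\mid g^k\in H\text{ for some }k\in\mathbb Z,\ k\ne0\}$; $G$ is regular if $Z(G)\le\mathrm{Is}(G')$. $\mathcal N_c$ is the variety of all nilpotent groups of class at most $c$. For $A=\{a_1,\dots,a_n\}$ and a finite set $R=\{r_1,\dots,r_m\}$ of words in $A^{\pm1}$, $\langle A\mid R\rangle_{\mathcal N_c}=N_c(A)/\langle\langle R\rangle\rangle$, where $N_c(A)=F(A)/\gamma_{c+1}(F(A))$ is the free group in $\mathcal N_c$ with basis $A$ and $\langle\langle R\rangle\rangle$ is the normal closure of $R$. The relation matrix $M(A,R)$ is the $m\times n$ integer matrix whose $(i,j)$ entry is the sum of the exponents of all occurrences of $a_j$ in $r_i$; the presentation has full rank if $\operatorname{rank}M(A,R)=\min\{m,n\}$. *)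

(* Defs.v *)
From HB Require Import structures.
From mathcomp Require Import all_boot all_order all_algebra.
From mathcomp Require Import boolp classical_sets.

Set Implicit Arguments.
Unset Strict Implicit.
Unset Printing Implicit Defensive.

Local Open Scope classical_set_scope.
Local Open Scope group_scope.
Local Open Scope quotient_scope.

Section Subgroups.
Variable G : groupType.
Implicit Types (H K S : set G) (g x : G).

Definition is_subgroup H : Prop :=
  H 1 /\ forall x y, H x -> H y -> H (x * y^-1).

Definition is_normal H : Prop :=
  is_subgroup H /\ forall x g, H x -> H (x ^ g).

Definition generated S : set G := smallest is_subgroup S.

Definition normal_closure S : set G := smallest is_normal S.

Definition commutator_subgroup H K : set G :=
  generated [set [~ h, k] | h in H & k in K].

Definition derived : set G := commutator_subgroup setT setT.

(* gamma 1 = G and gamma i.+1 = [gamma i, G]; the index 0 is not used. *)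
Fixpoint gamma (i : nat) : set G :=
  match i with
  | j.+1 => if j is 0 then setT else commutator_subgroup (gamma j) setT
  | 0 => setT
  end.

Definition center : set G := [set z | forall x, z * x = x * z].

Definition expgz g (k : int) : G :=
  match k with Posz i => g ^+ i | Negz i => g ^- i.+1 end.

Definition isolator H : set G :=
  [set g | exists k : int, k <> 0%R /\ H (expgz g k)].

Definition regular : Prop := center `<=` isolator derived.

(* Class exactly c: c is the least k such that gamma k.+1 is trivial. *)
Definition nilpotent_of_class (c : nat) : Prop :=
  forall k : nat, gamma k.+1 = [set 1] <-> (c <= k)%N.

Lemma subgroupV H x : is_subgroup H -> H x -> H x^-1.
Proof. by move=> [H1 HB] Hx; rewrite -[x^-1]mul1g; apply: HB. Qed.

Lemma subgroupM H x y : is_subgroup H -> H x -> H y -> H (x * y).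
Proof.
by move=> Hs Hx Hy; rewrite -[y]invgK; apply: Hs.2 => //; apply: subgroupV.
Qed.

Lemma generated_subgroup S : is_subgroup (generated S).
Proof.
split=> [K [[]]//|x y Sx Sy K [Ks SK]].
by apply: Ks.2; [apply: Sx | apply: Sy].
Qed.

Lemma sub_generated S : S `<=` generated S.
Proof. exact: sub_smallest. Qed.

Lemma normal_closure_normal S : is_normal (normal_closure S).
Proof.
split; first split=> [K [[[]]]//|x y Sx Sy K [Kn SK]].
  by apply: Kn.1.2; [apply: Sx | apply: Sy].
by move=> x g Sx K [Kn SK]; apply: Kn.2; apply: Sx.
Qed.

Lemma commutatorT_normal H :
  is_normal H -> is_normal (commutator_subgroup H setT).
Proof.
move=> Hn; split; first exact: generated_subgroup.
move=> x g xHG K [Ks SK].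
pose L : set G := [set y | K (y ^ g)].
apply: (xHG L); split.
  split; first by rewrite /L /= conj1g; apply: Ks.1.
  by move=> u v Lu Lv; rewrite /L /= conjMg conjVg; apply: Ks.2.
move=> _ [h Hh [k _ <-]]; rewrite /L /= conjRg; apply: SK.
by exists (h ^ g); [apply: Hn.2 | exists (k ^ g)].
Qed.

Lemma setT_normal : is_normal (@setT G).
Proof. by []. Qed.

Lemma gamma_normal i : is_normal (gamma i).
Proof.
elim: i => [|[|i] IH]; [exact: setT_normal | exact: setT_normal |].
exact: commutatorT_normal.
Qed.

End Subgroups.

Arguments derived : clear implicits.
Arguments gamma : clear implicits.
Arguments center : clear implicits.
Arguments regular : clear implicits.
Arguments nilpotent_of_class : clear implicits.

Definition isomorphic (G H : groupType) : Prop :=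
  exists f : {multiplicative G -> H}, bijective f.

Record normalSubgroup (G : groupType) := NormalSubgroup {
  normal_set :> set G;
  normal_setP : is_normal normal_set }.

Section Quotient.
Variables (G : groupType) (N : normalSubgroup G).

Definition coset_rel (x y : G) : bool := `[< normal_set N (x^-1 * y) >].

Let Nn : is_normal N := normal_setP N.

Lemma coset_rel_equiv : equiv_class_of coset_rel.
Proof.
have Ns := Nn.1; split.
- by move=> x; apply/asboolP; rewrite mulVg; apply: Ns.1.
- move=> x y; apply/asboolP/asboolP => /(subgroupV Ns);
  by rewrite invgM invgK.
- move=> y x z /asboolP xy /asboolP yz; apply/asboolP.
  by have := subgroupM Ns xy yz; rewrite mulgA mulgK.
Qed.

Canonical coset_equiv := EquivRelPack coset_rel_equiv.

Definition quotient_group : Type := {eq_quot coset_equiv}.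

HB.instance Definition _ := Choice.on quotient_group.

Definition quotient_map (x : G) : quotient_group := \pi_{eq_quot coset_equiv} x.
Definition quotient_repr (u : quotient_group) : G :=
  repr (u : {eq_quot coset_equiv}).

Lemma quotient_mapP (x y : G) :
  quotient_map x = quotient_map y <-> normal_set N (x^-1 * y).
Proof. by split=> [/eqmodP/asboolP//|xy]; apply/eqmodP/asboolP. Qed.

Lemma quotient_reprK (u : quotient_group) : quotient_map (quotient_repr u) = u.
Proof. exact: reprK. Qed.

Definition quot_mul (u v : quotient_group) : quotient_group :=
  quotient_map (quotient_repr u * quotient_repr v).
Definition quot_one : quotient_group := quotient_map 1.
Definition quot_inv (u : quotient_group) : quotient_group :=
  quotient_map (quotient_repr u)^-1.

Lemma quot_mulE (x y : G) :
  quot_mul (quotient_map x) (quotient_map y) = quotient_map (x * y).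
Proof.
apply/quotient_mapP.
have /quotient_mapP := quotient_reprK (quotient_map x).
have /quotient_mapP := quotient_reprK (quotient_map y).
set a := quotient_repr _; set b := quotient_repr _ => hy hx.
have -> : (b * a)^-1 * (x * y) = (b^-1 * x) ^ a * (a^-1 * y).
  by rewrite /conjg invgM !mulgA mulgK.
by apply: (subgroupM Nn.1) => //; apply: Nn.2.
Qed.

Lemma quot_invE (x : G) : quot_inv (quotient_map x) = quotient_map x^-1.
Proof.
apply/quotient_mapP; rewrite invgK.
have /esym/quotient_mapP := quotient_reprK (quotient_map x).
set a := quotient_repr _ => hx.
have -> : a * x^-1 = (x^-1 * a) ^ x^-1 by rewrite /conjg invgK !mulgA mulgV mul1g.
exact: Nn.2.
Qed.

Lemma quot_mulA : associative quot_mul.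
Proof.
move=> u v w; rewrite -(quotient_reprK u) -(quotient_reprK v).
by rewrite -(quotient_reprK w) !quot_mulE mulgA.
Qed.
Lemma quot_mul1g : left_id quot_one quot_mul.
Proof. by move=> u; rewrite -(quotient_reprK u) quot_mulE mul1g. Qed.
Lemma quot_mulg1 : right_id quot_one quot_mul.
Proof. by move=> u; rewrite -(quotient_reprK u) quot_mulE mulg1. Qed.
Lemma quot_mulVg : left_inverse quot_one quot_inv quot_mul.
Proof. by move=> u; rewrite -(quotient_reprK u) quot_invE quot_mulE mulVg. Qed.
Lemma quot_mulgV : right_inverse quot_one quot_inv quot_mul.
Proof. by move=> u; rewrite -(quotient_reprK u) quot_invE quot_mulE mulgV. Qed.

HB.instance Definition _ := isGroup.Build quotient_group
  quot_mulA quot_mul1g quot_mulg1 quot_mulVg quot_mulgV.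

End Quotient.

(* The letter (j, false) stands for a_j and (j, true) for its inverse. *)
Definition letter (n : nat) : Type := ('I_n * bool)%type.
Definition word (n : nat) : Type := seq ('I_n * bool).

Section FreeGroup.
Variable n : nat.
Implicit Types (x y : 'I_n * bool) (s u v w : seq ('I_n * bool)).

Definition flip x : 'I_n * bool := (x.1, ~~ x.2).

(* Prepends a letter to a freely reduced word, cancelling if needed. *)
Definition push x s : word n :=
  if s is y :: s' then (if y == flip x then s' else x :: s) else [:: x].

Definition reduce w : word n := foldr push [::] w.

Definition reduced w : bool := sorted (fun x y => y != flip x) w.

Lemma flipK : involutive flip.
Proof. by case=> i b; rewrite /flip /= negbK. Qed.

Lemma push_reduced x s : reduced s -> reduced (push x s).
Proof.
rewrite /reduced; case: s => [//|y s] /=; case: ifP => [_ /path_sorted//|yx].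
by move=> /= ->; rewrite yx.
Qed.

Lemma foldr_push_reduced w s : reduced s -> reduced (foldr push s w).
Proof. by move=> rs; elim: w => //= x w; apply: push_reduced. Qed.

Lemma reduce_reduced w : reduced (reduce w).
Proof. exact: foldr_push_reduced. Qed.

Lemma pushK x s : reduced s -> push x (push (flip x) s) = s.
Proof.
case: s => [_|y s rs] /=; first by rewrite eqxx.
rewrite flipK; case: (eqVneq y x) rs => [-> |_ _] /=; last by rewrite eqxx.
by case: s => [//|z s] /andP[/negPf /= -> _].
Qed.

Lemma reduce_id s : reduced s -> reduce s = s.
Proof.
elim: s => [//|x [//|y s] IH] /andP[/= yx rs].
by rewrite -[LHS]/(push x (reduce (y :: s))) IH //= (negPf yx).
Qed.

Lemma foldr_push_push s x u : reduced s ->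
  foldr push s (push x u) = push x (foldr push s u).
Proof.
move=> rs; case: u => [//|y u] /=; case: eqP => [-> |//].
by rewrite pushK // foldr_push_reduced.
Qed.

Lemma foldr_push_reduce s w : reduced s ->
  foldr push s (reduce w) = foldr push s w.
Proof. by move=> rs; elim: w => //= x w <-; rewrite foldr_push_push. Qed.

Lemma reduce_cat u v : reduce (reduce u ++ reduce v) = reduce (u ++ v).
Proof.
rewrite /reduce !foldr_cat -/(reduce (reduce v)) reduce_id ?reduce_reduced //.
by rewrite foldr_push_reduce // reduce_reduced.
Qed.

Definition word_inv w : word n := rev (map flip w).

Lemma reduce_catV w : reduce (word_inv w ++ w) = [::].
Proof.
rewrite /word_inv; elim: w => [//|x w IH].
rewrite /= rev_cons cat_rcons /reduce foldr_cat /=.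
have := pushK (flip x) (reduce_reduced w); rewrite flipK => ->.
by rewrite -foldr_cat.
Qed.

Record free_group : Type := FreeGroup {
  free_word :> seq ('I_n * bool);
  free_wordP : reduced free_word }.

HB.instance Definition _ := [isSub for free_word].
HB.instance Definition _ := [Choice of free_group by <:].

Definition of_word w : free_group := FreeGroup (reduce_reduced w).

Definition free_mul (u v : free_group) : free_group := of_word (u ++ v).
Definition free_one : free_group := of_word [::].
Definition free_inv (u : free_group) : free_group := of_word (word_inv u).

Lemma free_reduce (u : free_group) : reduce u = u.
Proof. exact/reduce_id/free_wordP. Qed.

Lemma free_mulA : associative free_mul.
Proof.
move=> u v w; apply: val_inj => /=.
by rewrite -{1}[val u]free_reduce -{2}[val w]free_reduce !reduce_cat catA.
Qed.
Lemma free_mul1g : left_id free_one free_mul.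
Proof. by move=> u; apply: val_inj; rewrite /= free_reduce. Qed.
Lemma free_mulg1 : right_id free_one free_mul.
Proof. by move=> u; apply: val_inj; rewrite /= cats0 free_reduce. Qed.
Lemma free_mulVg : left_inverse free_one free_inv free_mul.
Proof.
move=> u; apply: val_inj => /=.
by rewrite -{2}[val u]free_reduce reduce_cat reduce_catV.
Qed.
Lemma free_mulgV : right_inverse free_one free_inv free_mul.
Proof.
move=> u; apply: val_inj => /=.
rewrite -{1}[val u]free_reduce reduce_cat.
have {1}-> : val u = word_inv (word_inv u).
  by rewrite /word_inv map_rev revK -map_comp (eq_map flipK) map_id.
by rewrite reduce_catV.
Qed.

HB.instance Definition _ := isGroup.Build free_group
  free_mulA free_mul1g free_mulg1 free_mulVg free_mulgV.

End FreeGroup.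

(* N_c(A) = F(A) / gamma_{c+1}(F(A)). *)
Definition free_nilpotent (c n : nat) : groupType :=
  quotient_group (NormalSubgroup (gamma_normal (free_group n) c.+1)).

Definition of_word_nilpotent (c n : nat) (w : word n) : free_nilpotent c n :=
  quotient_map (NormalSubgroup (gamma_normal (free_group n) c.+1)) (of_word w).

Definition nilpotent_presentation (c n m : nat) (r : 'I_m -> word n) :
    groupType :=
  quotient_group (NormalSubgroup
    (normal_closure_normal (range (fun i => of_word_nilpotent c (r i))))).

Definition exponent_sum (n : nat) (w : word n) (j : 'I_n) : int :=
  (\sum_(x <- w | x.1 == j) (-1) ^+ x.2)%R.

Definition relation_matrix (n m : nat) (r : 'I_m -> word n) : 'M[int]_(m, n) :=
  (\matrix_(i < m, j < n) exponent_sum (r i) j)%R.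

(* The rank of an integer matrix is taken over the rationals. *)
Definition full_rank (n m : nat) (r : 'I_m -> word n) : Prop :=
  \rank (map_mx (intr : int -> rat) (relation_matrix r)) = minn m n.

(* Main.v *)
From HB Require Import structures.
Require Import Defs.
From mathcomp Require Import all_boot all_order all_algebra.
From mathcomp Require Import boolp classical_sets.
From mathcomp Require Import ring.

Set Implicit Arguments.
Unset Strict Implicit.
Unset Printing Implicit Defensive.

Import GRing.Theory.

(** Everything already happens in class two. Let M be the relation matrix, R
    the lattice spanned by its rows in Z^n, and A = Z^n / R the abelianization
    of G. Because the rows of M are independent, no relation among commutators
    arises except the forced ones, and G'/[G',G] is the exterior square of A. As
    A has rank n - m >= 2, a nonzero element of A has a nonzero
    exterior product with some other element, so it cannot lift to a central
    element of G.

    The exterior square is only probed through one alternating form at a time.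
    Let z be central, represented by a word with exponent row v. There are
    m + 1 < n linear conditions M f = 0 and v f = 0, so they have a primitive
    integer solution f, i.e. one with y f = 1 for some y
    ([unimodular_ker_vector], from the Smith normal form). The column f defines
    a group law on Z^n x Z^n,

      (a, x) (b, y) = (a + b + (y f) x, x + y),

    which is nilpotent of class two, with commutators
    [(a, x), (b, y)] = ((y f) x - (x f) y, 0). Send a_j to (0, e_j). The images
    of the relators are pairs (C_i, M_i), M_i being a row of M; since M f = 0,
    their normal closure is contained in the set of all pairs
    (s M + t C, t M) ([relator_span_normal]). The commutator [z, a_j] is trivial
    in G, hence its image (f_j v, 0) has this form. Full rank forces t = 0, so
    f_j v lies in R for every j ([presentation_commute_lattice]), and therefore
    so does v = sum_j y_j f_j v. A word whose exponent row is in R represents an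
    element of G' ([lattice_derived]), so z lies in G'. *)

Local Open Scope classical_set_scope.

(** * Morphisms of groups *)

Lemma group_monoid_morphism (G H : groupType) (h : G -> H) :
  {morph h : x y / (x * y)%g} -> monoid.monoid_morphism h.
Proof.
by move=> hM; split=> //; apply: (@mulgI _ (h 1%g)); rewrite -hM !mulg1.
Qed.

Lemma isomorphic_morphism (G H : groupType) :
  isomorphic G H -> exists h : UMagmaMorphism.type G H, bijective h.
Proof.
move=> [h h_bij].
pose hM := isUMagmaMorphism.Build G H h (group_monoid_morphism (@gmulfM _ _ h)).
pose h1 : UMagmaMorphism.type G H := HB.pack (h : G -> H) hM.
by exists h1.
Qed.

(** * Word evaluation *)

Section WordEval.
Local Open Scope group_scope.
Variables (G : groupType) (n : nat) (g : 'I_n -> G).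
Implicit Types (x : 'I_n * bool) (u v w : seq ('I_n * bool)).

Definition letter_eval x : G := if x.2 then (g x.1)^-1 else g x.1.

Definition word_eval w : G := \big[*%g/1]_(x <- w) letter_eval x.

Lemma word_eval_push x w : word_eval (push x w) = letter_eval x * word_eval w.
Proof.
rewrite /word_eval; case: w => [|y w] /=.
  by rewrite big_seq1 big_nil mulg1.
case: eqP => [->|_]; last by rewrite big_cons.
rewrite big_cons mulgA; case: x => i [] /=;
by rewrite /letter_eval /= ?mulVg ?mulgV mul1g.
Qed.

Lemma word_eval_reduce w : word_eval (reduce w) = word_eval w.
Proof.
elim: w => [//|x w IH].
rewrite -[reduce _]/(push x (reduce w)) word_eval_push IH.
by rewrite /word_eval big_cons.
Qed.

(** The universal property of the free group: reduction does not change the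
    value of a word, so evaluation descends to reduced words. *)
Definition free_eval (u : free_group n) : G := word_eval u.

Fact free_eval_is_multiplicative : {morph free_eval : u v / u * v}.
Proof.
by move=> u v; rewrite /free_eval word_eval_reduce /word_eval big_cat.
Qed.

HB.instance Definition _ :=
  isUMagmaMorphism.Build (free_group n) G free_eval
    (group_monoid_morphism free_eval_is_multiplicative).

Lemma free_eval_of_word w : free_eval (of_word w) = word_eval w.
Proof. exact: word_eval_reduce. Qed.

End WordEval.

(** In an abelian group the order of the letters is lost and only exponent sums
    remain. Two cases matter: the abelianization map, and the projection of the
    Heisenberg group onto its second factor. *)
Lemma additive_word_eval (G : groupType) (A : zmodType) (p : G -> A)
    (pM : forall x y, p (x * y)%g = (p x + p y)%R) n (g : 'I_n -> G) w :
  p (word_eval g w) = (\sum_(j < n) p (g j) *~ exponent_sum w j)%R.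
Proof.
have p1 : p 1%g = 0%R by apply: (@addrI _ (p 1%g)); rewrite -pM mulg1 addr0.
have pV x : p x^-1%g = (- p x)%R.
  by apply/eqP; rewrite -addr_eq0 -pM mulVg p1 eqxx.
rewrite /word_eval /exponent_sum; elim: w => [|x w IH].
  by rewrite big_nil p1 big1 // => j _; rewrite big_nil.
rewrite big_cons pM {}IH (bigD1 x.1) //= [RHS](bigD1 x.1) //= addrA.
rewrite big_cons eqxx mulrzDr; congr (_ + _ + _)%R; last first.
  by apply: eq_bigr => j /negPf jx; rewrite big_cons eq_sym jx.
by case: x => i []; rewrite /letter_eval //= pV expr1 mulrN1z.
Qed.

Definition free_gen n (j : 'I_n) : free_group n := of_word [:: (j, false)].

Lemma word_eval_free_gen n w : word_eval (@free_gen n) w = of_word w.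
Proof.
rewrite /word_eval; elim: w => [|x w IH]; first by rewrite big_nil.
have -> : of_word (x :: w) = (of_word [:: x] * of_word w)%g.
  by apply: val_inj; apply: esym (reduce_cat [:: x] w).
rewrite big_cons IH; congr (_ * _)%g; by case: x => j [].
Qed.

Lemma of_free_word n (u : free_group n) : of_word u = u.
Proof. by apply: val_inj; rewrite /= free_reduce. Qed.

Lemma quotient_map_is_multiplicative (G : groupType) (N : normalSubgroup G) :
  {morph @quotient_map G N : x y / (x * y)%g}.
Proof. by move=> x y; rewrite -[LHS]quot_mulE. Qed.

HB.instance Definition _ (G : groupType) (N : normalSubgroup G) :=
  isUMagmaMorphism.Build G (quotient_group N) (@quotient_map G N)
    (group_monoid_morphism (@quotient_map_is_multiplicative G N)).

(** * The abelianization *)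

Section Abelianization.
Variable G : groupType.

Lemma derived_normal : is_normal (derived G).
Proof. exact/commutatorT_normal/setT_normal. Qed.

(** The quotient by the derived subgroup, written additively so that exponent
    sums can act on it as integer multiples. *)
Definition abelianization : Type :=
  quotient_group (NormalSubgroup derived_normal).
HB.instance Definition _ := Choice.on abelianization.

Definition to_ab (x : G) : abelianization :=
  quotient_map (NormalSubgroup derived_normal) x.

Let ab_add (u v : abelianization) : abelianization := quot_mul u v.

Lemma ab_addE x y : ab_add (to_ab x) (to_ab y) = to_ab (x * y)%g.
Proof. exact: quot_mulE. Qed.

Lemma ab_addC : commutative ab_add.
Proof.
move=> u v; rewrite -[u]quotient_reprK -[v]quotient_reprK.
move: (quotient_repr u) (quotient_repr v) => x y; rewrite !ab_addE.
apply/quotient_mapP; apply: sub_generated.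
by exists y => //; exists x => //; rewrite commgEl conjgE invgM !mulgA.
Qed.

HB.instance Definition _ := GRing.isZmodule.Build abelianization
  (@quot_mulA _ _) ab_addC (@quot_mul1g _ _) (@quot_mulVg _ _).

Lemma to_abM x y : to_ab (x * y)%g = (to_ab x + to_ab y)%R.
Proof. by rewrite -[LHS]ab_addE. Qed.

Lemma to_ab_eq0 x : to_ab x = 0%R <-> derived G x.
Proof.
split=> [/esym/quotient_mapP | dx]; first by rewrite invg1 mul1g.
by apply/esym/quotient_mapP; rewrite invg1 mul1g.
Qed.

End Abelianization.

(** * Normal subgroups and the lower central series *)

Section Subgroups.
Local Open Scope group_scope.

Lemma generated_sub (G : groupType) (S K : set G) :
  is_subgroup K -> S `<=` K -> generated S `<=` K.
Proof. by move=> Ks SK; apply: smallest_sub. Qed.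

Variables (G H : groupType) (h : UMagmaMorphism.type G H).

Lemma gmulfR x y : h [~ x, y] = [~ h x, h y].
Proof. by rewrite /commg /conjg !gmulfM !gmulfV. Qed.

Lemma gmulfJ x y : h (x ^ y) = h x ^ h y.
Proof. by rewrite /conjg !gmulfM !gmulfV. Qed.

Lemma preimage_subgroup (K : set H) : is_subgroup K -> is_subgroup (h @^-1` K).
Proof.
move=> [K1 KB]; split=> [|x y Kx Ky]; rewrite /preimage /=.
  by rewrite gmulf1.
by rewrite gmulfM gmulfV; apply: KB.
Qed.

Lemma preimage_normal (K : set H) : is_normal K -> is_normal (h @^-1` K).
Proof.
move=> [Ks KJ]; split; first exact: preimage_subgroup.
by move=> x g Kx; rewrite /preimage /= gmulfJ; apply: KJ.
Qed.

Lemma commutator_subgroup_morph (A B : set G) (A' B' : set H) :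
  A `<=` h @^-1` A' -> B `<=` h @^-1` B' ->
  commutator_subgroup A B `<=` h @^-1` commutator_subgroup A' B'.
Proof.
move=> AA' BB'; apply: generated_sub.
  exact/preimage_subgroup/generated_subgroup.
move=> _ [a Aa [b Bb <-]]; rewrite /preimage /= gmulfR; apply: sub_generated.
by exists (h a); [apply: AA' | exists (h b); [apply: BB'|]].
Qed.

Lemma gamma_morph i : gamma G i `<=` h @^-1` gamma H i.
Proof.
elim: i => [//|[|i] IH]; first by [].
exact: commutator_subgroup_morph.
Qed.

Lemma image_normal (K : set G) :
  (forall y, exists x, h x = y) -> is_normal K -> is_normal (h @` K).
Proof.
move=> h_surj [[K1 KB] KJ]; split; first split.
- by exists 1 => //; rewrite gmulf1.
- move=> _ _ [x Kx <-] [y Ky <-]; exists (x * y^-1); first exact: KB.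
  by rewrite gmulfM gmulfV.
- move=> _ g [x Kx <-]; have [g' <-] := h_surj g.
  by exists (x ^ g'); [apply: KJ | rewrite gmulfJ].
Qed.

End Subgroups.

(** * The projection from the free group onto a presented group *)

Section Presentation.
Local Open Scope group_scope.
Variables (c n m : nat) (r : 'I_m -> word n).

Definition presentation_map (u : free_group n) : nilpotent_presentation c r :=
  quotient_map _ (quotient_map _ u).

Fact presentation_map_is_multiplicative :
  {morph presentation_map : u v / u * v}.
Proof. by move=> u v; rewrite /presentation_map !gmulfM. Qed.

HB.instance Definition _ :=
  isUMagmaMorphism.Build (free_group n) (nilpotent_presentation c r)
    presentation_map (group_monoid_morphism presentation_map_is_multiplicative).

Lemma presentation_map_surj p : exists u, presentation_map u = p.
Proof.
exists (quotient_repr (quotient_repr p)).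
by rewrite /presentation_map !quotient_reprK.
Qed.

Lemma presentation_map_relator i : presentation_map (of_word (r i)) = 1.
Proof.
apply/esym/quotient_mapP; rewrite invg1 mul1g => K [_]; apply; by exists i.
Qed.

(** The presented group is a quotient of a quotient, but a bound on the kernel
    of the projection can be given directly in the free group: the image of K in
    the free nilpotent group is normal and contains the relators, and passing
    back to the free group costs only an element of [gamma c.+1]. *)
Lemma presentation_map_ker (K : set (free_group n)) :
    is_normal K -> gamma (free_group n) c.+1 `<=` K ->
    (forall i, K (of_word (r i))) ->
  forall u, presentation_map u = 1 -> K u.
Proof.
move=> Kn gK rK u /esym/quotient_mapP; rewrite invg1 mul1g.
set N := NormalSubgroup (gamma_normal (free_group n) c.+1).
move=> /(_ (@quotient_map _ N @` K)) [].
  split.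
    apply: image_normal => // y; exists (quotient_repr y).
    exact: quotient_reprK.
  by move=> _ [i _ <-]; exists (of_word (r i)).
move=> x Kx /quotient_mapP/gK Kxu.
by rewrite -(mulVKg x u); apply: subgroupM => //; apply: Kn.1.
Qed.

End Presentation.

(** * A Heisenberg group *)

(** The central extension of Z^n by Z^n with cocycle (x, y) |-> (y f) x. The
    column f occurs in the type so that the group law can depend on it. *)
Definition heis n (f : 'cV[int]_n) : Type := ('rV[int]_n * 'rV[int]_n)%type.

Section Heisenberg.
Variables (n : nat) (f : 'cV[int]_n).
Local Open Scope ring_scope.

HB.instance Definition _ := Choice.on (heis f).

Definition heis_mul (a b : heis f) : heis f :=
  (a.1 + b.1 + b.2 *m f *m a.2, a.2 + b.2).
Definition heis_one : heis f := (0, 0).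
Definition heis_inv (a : heis f) : heis f := (- a.1 + a.2 *m f *m a.2, - a.2).

Fact heis_mulA : associative heis_mul.
Proof.
move=> [a x] [b y] [d z]; congr pair; rewrite /= ?addrA //.
rewrite !mulmxDl !mulmxDr.
move: (_ *m _ *m _) (_ *m _ *m _) (_ *m _ *m _) => p q s.
by apply/rowP => i; rewrite !mxE; ring.
Qed.
Fact heis_mul1g : left_id heis_one heis_mul.
Proof. by move=> [a x]; rewrite /heis_mul /= mulmx0 !add0r addr0. Qed.
Fact heis_mulg1 : right_id heis_one heis_mul.
Proof. by move=> [a x]; rewrite /heis_mul /= !mul0mx !addr0. Qed.
Fact heis_mulVg : left_inverse heis_one heis_inv heis_mul.
Proof.
move=> [a x]; rewrite /heis_mul /heis_inv /= mulmxN.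
by rewrite addrAC addrK !addNr.
Qed.
Fact heis_mulgV : right_inverse heis_one heis_inv heis_mul.
Proof.
move=> [a x]; rewrite /heis_mul /heis_inv /= addrN !mulNmx.
by rewrite addrA addrN add0r addrN.
Qed.

HB.instance Definition _ := isGroup.Build (heis f)
  heis_mulA heis_mul1g heis_mulg1 heis_mulVg heis_mulgV.

Lemma heis_mulE (a b : heis f) :
  (a * b)%g = (a.1 + b.1 + b.2 *m f *m a.2, a.2 + b.2).
Proof. by []. Qed.

Lemma heis_invE (a : heis f) : a^-1%g = (- a.1 + a.2 *m f *m a.2, - a.2).
Proof. by []. Qed.

Lemma heis_conjgE (a b : heis f) :
  (a ^ b)%g = (a.1 + b.2 *m f *m a.2 - a.2 *m f *m b.2, a.2).
Proof.
apply: (mulgI b); rewrite -conjgC !heis_mulE /=; congr pair; last exact: addrC.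
move: (_ *m _ *m _) (_ *m _ *m _) => p q.
by apply/rowP => i; rewrite !mxE; ring.
Qed.

Lemma heis_commgE (a b : heis f) :
  [~ a, b]%g = (b.2 *m f *m a.2 - a.2 *m f *m b.2, 0).
Proof.
apply: (mulgI a); rewrite commgEl mulVKg heis_conjgE heis_mulE /=.
by rewrite !mul0mx !addr0 addrA.
Qed.

Lemma heis_gamma2 : gamma (heis f) 2 `<=` [set a | a.2 = 0].
Proof.
apply: generated_sub.
  split=> [//|a b /= a2 b2].
  by rewrite a2 b2 subr0.
by move=> _ [a _ [b _ <-]]; rewrite heis_commgE.
Qed.

Lemma heis_gamma3 c : (2 <= c)%N -> gamma (heis f) c.+1 `<=` [set 1%g].
Proof.
case: c => [//|[//|k]] _; elim: k => [|k IH]; apply: generated_sub.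
- by split=> [//|a b -> ->]; rewrite /= divgg.
- move=> _ [a /heis_gamma2 /= a2 [b _ <-]].
  by rewrite heis_commgE a2 mulmx0 !mul0mx subr0.
- by split=> [//|a b -> ->]; rewrite /= divgg.
- by move=> _ [a /IH -> [b _ <-]]; rewrite /= comm1g.
Qed.

(** In the application (C_i, M_i) is the image of the i-th relator. The first
    components then also absorb s M, because conjugating (C_i, M_i) by (b, y)
    changes it by ((y f) M_i, 0). *)
Definition relator_span m (M C : 'M[int]_(m, n)) : set (heis f) :=
  [set a | exists s t : 'rV_m, a = (s *m M + t *m C, t *m M)].

(** The condition M f = 0 kills the cocycle on second components t M, so that
    products are taken componentwise, and makes conjugation move the first
    component only by multiples of t M. *)
Lemma relator_span_normal m (M C : 'M[int]_(m, n)) :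
  M *m f = 0 -> is_normal (relator_span M C).
Proof.
move=> Mf; split; first split.
- by exists 0, 0; rewrite !mul0mx addr0.
- move=> _ _ [s [t ->]] [s' [t' ->]]; exists (s - s'), (t - t').
  rewrite heis_mulE heis_invE /= mulNmx -[t' *m M *m f]mulmxA Mf mulmx0.
  rewrite !mul0mx oppr0 mul0mx !addr0 !mulmxBl; congr pair.
  by rewrite opprD addrACA.
- move=> _ b [s [t ->]]; rewrite heis_conjgE /=.
  exists (s + b.2 *m f *m t), t.
  rewrite -[t *m M *m f]mulmxA Mf mulmx0 mul0mx subr0 mulmxDl !mulmxA.
  by congr pair; apply: addrAC.
Qed.

End Heisenberg.
Arguments relator_span {n} f {m} M C.

(** * The relation lattice *)

Section RelationLattice.
Local Open Scope ring_scope.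

Definition exponent_row n (w : word n) : 'rV[int]_n :=
  \row_j exponent_sum w j.

Lemma row_relation_matrix n m (r : 'I_m -> word n) i :
  row i (relation_matrix r) = exponent_row (r i).
Proof. by apply/rowP => j; rewrite !mxE. Qed.

(** Write N = L D P in Smith normal form. As D has more columns than rows, its
    last column vanishes; the last column of the inverse of P and the last row
    of P are then the required f and y. *)
Lemma unimodular_ker_vector k n (N : 'M[int]_(k, n)) : (k < n)%N ->
  exists (f : 'cV[int]_n) (y : 'rV[int]_n), N *m f = 0 /\ y *m f = 1%:M.
Proof.
case: n N => // n N kn.
have [L _ [P Pu [d _ ->]]] := int_Smith_normal_form N.
exists (invmx P *m delta_mx ord_max 0), (delta_mx 0 ord_max *m P); split.
  rewrite mulmxA mulmxK // -mulmxA -colE.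
  rewrite (_ : col _ _ = 0) ?mulmx0 //; apply/colP => i; rewrite !mxE /=.
  by rewrite ltn_eqF ?mulr0n // (leq_trans (ltn_ord i)).
rewrite mulmxA mulmxK // mul_delta_mx.
by apply/matrixP => i j; rewrite !mxE !ord1.
Qed.

Lemma full_rank_row_free n m (r : 'I_m -> word n) (t : 'rV[int]_m) :
  (m <= n)%N -> full_rank r -> t *m relation_matrix r = 0 -> t = 0.
Proof.
rewrite /full_rank => /minn_idPl -> /eqP rf tM.
pose toQ := intr : int -> rat.
set MQ := map_mx _ _ in rf.
have /(row_free_inj rf) : map_mx toQ t *m MQ = 0 *m MQ.
  by rewrite -map_mxM tM mul0mx map_mx0.
move=> /matrixP tQ; apply/matrixP => i j.
by have := tQ i j; rewrite !mxE => /eqP; rewrite intr_eq0 => /eqP.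
Qed.

Variables (n : nat) (f : 'cV[int]_n).

Definition heis_gen (j : 'I_n) : heis f := (0, delta_mx 0 j).

Lemma heis_gen_eval2 w : (word_eval heis_gen w).2 = exponent_row w.
Proof.
rewrite (additive_word_eval (A := 'rV[int]_n) (p := fun a : heis f => a.2)) //.
rewrite [RHS]row_sum_delta; apply: eq_bigr => j _.
by rewrite mxE -scaler_int intz.
Qed.

(** The commutator of u with the j-th generator is a consequence of the
    relators, and its value in the Heisenberg group is (f_j v, 0), where v is
    the exponent row of u. A consequence of the relators with second component
    t M = 0 has t = 0 by full rank, hence a first component in the row lattice
    of M. *)
Lemma presentation_commute_lattice c m (r : 'I_m -> word n) (u : free_group n) :
    (2 <= c)%N -> (m <= n)%N -> full_rank r ->
    relation_matrix r *m f = 0 -> exponent_row u *m f = 0 ->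
    (forall p, commute (presentation_map c r u) p) ->
  forall j, exists s, f j 0 *: exponent_row u = s *m relation_matrix r.
Proof.
move=> c2 mn rfull Mf uf uC j.
set M := relation_matrix r in Mf *.
pose C : 'M[int]_(m, n) := \matrix_i (word_eval heis_gen (r i)).1.
have : relator_span f M C (free_eval heis_gen [~ u, free_gen j]%g).
  pose K := free_eval heis_gen @^-1` relator_span f M C.
  apply: (@presentation_map_ker c n m r K).
  - exact/preimage_normal/relator_span_normal.
  - move=> w /(gamma_morph (free_eval heis_gen)) /(heis_gamma3 c2).
    rewrite /K /preimage /= => ->; by exists 0, 0; rewrite !mul0mx addr0.
  - move=> i; exists 0, (delta_mx 0 i).
    rewrite mul0mx add0r -!rowE rowK row_relation_matrix -heis_gen_eval2.
    by rewrite free_eval_of_word; case: (word_eval _ _).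
  - by rewrite gmulfR; apply/eqP/commgP.
move=> [s [t]]; rewrite gmulfR heis_commgE /= => -[].
have -> : (free_eval heis_gen u).2 = exponent_row u by exact: heis_gen_eval2.
rewrite uf mul0mx subr0 => + /esym /(full_rank_row_free mn rfull) t0.
rewrite t0 mul0mx addr0 => sM; exists s.
rewrite -sM -mul_scalar_mx; congr (_ *m _).
rewrite (_ : (free_eval heis_gen (free_gen j)).2 = delta_mx 0 j) -?rowE.
  by apply/matrixP => a b; rewrite !ord1 !mxE.
by rewrite free_eval_of_word /word_eval big_seq1.
Qed.

End RelationLattice.

(** * The centre *)

Lemma derived_bij_preimage (G H : groupType) (h : UMagmaMorphism.type G H)
    z : bijective h -> derived H (h z) -> derived G z.
Proof.
move=> [h' hK h'K] dz.
suff [y dy /(can_inj hK) <-] : (h @` derived G) (h z) by [].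
move: (h z) dz; apply: generated_sub.
  by apply: (image_normal _ (derived_normal G)).1 => y; exists (h' y).
move=> _ [a _ [b _ <-]]; exists [~ h' a, h' b]%g; last by rewrite gmulfR !h'K.
by apply: sub_generated; exists (h' a) => //; exists (h' b).
Qed.

(** In the abelianization, an element with exponent row s M is the combination
    with coefficients s_i of the relators, which vanish there. *)
Lemma lattice_derived c n m (r : 'I_m -> word n) (u : free_group n) s :
  exponent_row u = (s *m relation_matrix r)%R ->
  derived (nilpotent_presentation c r) (presentation_map c r u).
Proof.
move=> us; apply/to_ab_eq0.
pose q v := to_ab (presentation_map c r v).
have qE w : q (of_word w) =
    (\sum_(j < n) q (free_gen j) *~ exponent_sum w j)%R.
  rewrite -word_eval_free_gen; apply: additive_word_eval => x y.
  by rewrite /q gmulfM to_abM.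
rewrite -[LHS]/(q u) -(of_free_word u) qE.
have -> : (\sum_(j < n) q (free_gen j) *~ exponent_sum u j =
    \sum_(i < m) q (of_word (r i)) *~ s 0 i)%R.
  under [RHS]eq_bigr => i _ do rewrite qE mulrz_suml.
  rewrite exchange_big /=; apply: eq_bigr => j _.
  have /rowP/(_ j) := us; rewrite !mxE => ->; rewrite mulrz_sumr.
  by apply: eq_bigr => i _; rewrite mxE mulrC mulrzA.
rewrite big1 // => i _; rewrite /q presentation_map_relator.
by rewrite (_ : to_ab 1%g = 0%R) // mul0rz.
Qed.

Theorem theorem4p12 (G : groupType) (c n m : nat) (r : 'I_m -> word n)
    (c_ge2 : (2 <= c)%N)
    (G_class : nilpotent_of_class G c)
    (G_pres : isomorphic G (nilpotent_presentation c r))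
    (r_full_rank : full_rank r)
    (m_le : (m + 2 <= n)%N) :
  center G `<=` derived G /\ regular G.
Proof.
suff ZG : center G `<=` derived G by split=> // z /ZG dz; exists (Posz 1).
move=> z zC; have [h h_bij] := isomorphic_morphism G_pres.
apply: (derived_bij_preimage h_bij).
have [u hz] := presentation_map_surj (h z); rewrite -hz.
have m_le_n : (m <= n)%N by rewrite (leq_trans _ m_le) ?leq_addr.
set M := relation_matrix r; set v := exponent_row u.
(* Besides M f = 0, also v f = 0 is imposed: it removes the term (v f) e_j from
   the commutator with a_j, and is affordable because m + 1 < n. *)
have [|f [y [/eqP Nf yf]]] := @unimodular_ker_vector _ _ (col_mx M v).
  by rewrite addn1 -addn2.
move: Nf; rewrite mul_col_mx col_mx_eq0 => /andP[/eqP Mf /eqP vf].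
have uC p : commute (presentation_map c r u) p.
  by have [h' _ h'K] := h_bij; rewrite hz -(h'K p) /commute -!gmulfM zC.
have /choice[s sE] :=
  presentation_commute_lattice c_ge2 m_le_n r_full_rank Mf vf uC.
apply: (@lattice_derived _ _ _ _ _ (\sum_j y 0 j *: s j)%R).
(* v = (y f) v = sum_j y_j (f_j v), and each f_j v is s_j M. *)
rewrite mulmx_suml; transitivity ((y *m f) 0 0 *: v)%R.
  by rewrite yf mxE scale1r.
rewrite mxE scaler_suml; apply: eq_bigr => j _.
by rewrite -scalemxAl -sE scalerA.
Qed.
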